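(* Let $E$ be a continuous signature, let $X$ be a semitopological $E$-algebra, let $Z$ be a topological space, and let $f\colon X\to Z$ be a continuous map (no separation axioms are assumed on any of the spaces). Then among all factorizations of $f$ there is a least one, i.e. a factorization $(g,Y,h)\in\mathfrak F(X,f,Z)$ such that $(g,Y,h)\prec(g',Y',h')$ for every $(g',Y',h')\in\mathfrak F(X,f,Z)$. Moreover, $Y$ is embedded (topologically) in $Z^A$ for some set $A$.
   Context: No separation axioms are assumed. A continuous signature is a topological space $E$ that is the disjoint union of clopen (possibly empty) subsets $E_n$, $n\in\omega=\{0,1,2,\dots\}$. An $E$-algebra is a set $X$ with maps $\mathfrak e^X_n\colon E_n\times X^n\to X$, $n\in\omega$ ($X^0$ is a singleton). A semitopological $E$-algebra is an $E$-algebra endowed with a topology such that every $\mathfrak e^X_n$ is separately continuous, i.e. continuous in each of its $n+1$ arguments when the others are fixed. A homomorphism is a map commuting with all operations. A factorization of a continuous map $f\colon X\to Z$ is a triple $(g,Y,h)$ where $Y$ is a semitopological $E$-algebra, $g\colon X\to Y$ is a continuous surjective homomorphism, $h\colon Y\to Z$ is continuous, and $f=h\circ g$. The collection of all factorizations is denoted $\mathfrak F(X,f,Z)$. The order on it is: $(g_1,Y_1,h_1)\prec(g_2,Y_2,h_2)$ if there is a continuous homomorphism $q\colon Y_2\to Y_1$ with $g_1=q\circ g_2$. *)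

(* Defs.v *)
(* A [topologicalType] is an arbitrary, possibly empty,
   topological space: no base point and no separation axiom is assumed. *)
From mathcomp Require Import all_boot.
From mathcomp Require Import all_classical all_analysis.

Set Implicit Arguments.
Unset Strict Implicit.
Unset Printing Implicit Defensive.

Local Open Scope classical_set_scope.

Record continuousSignature := ContinuousSignature {
  sig_space :> topologicalType;
  sig_part : nat -> set sig_space;
  sig_part_clopen : forall n, clopen (sig_part n);
  sig_part_disjoint : trivIset [set: nat] sig_part;
  sig_part_cover : \bigcup_n sig_part n = [set: sig_space] }.
Arguments sig_part : clear implicits.

(* The set [sig_part E n] is coerced to the subtype of its elements, which the
   library equips with the subspace topology; X^n is ['I_n -> X]. *)
Definition eAlgebra (E : continuousSignature) (X : Type) :=
  forall n, sig_part E n -> ('I_n -> X) -> X.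

(* [dfwith x i y] is the n-tuple x with its i-th entry replaced by y. *)
Definition separately_continuous (E : continuousSignature)
    (X : topologicalType) (op : eAlgebra E X) :=
  (forall n (x : 'I_n -> X), continuous (fun c : sig_part E n => op n c x)) /\
  (forall n (c : sig_part E n) (x : 'I_n -> X) (i : 'I_n),
     continuous (fun y : X => op n c (dfwith x i y))).

Record semitopAlgebra (E : continuousSignature) := SemitopAlgebra {
  alg_space :> topologicalType;
  alg_op : eAlgebra E alg_space;
  alg_sepcont : separately_continuous alg_op }.

Definition homomorphism (E : continuousSignature) (X Y : semitopAlgebra E)
    (g : X -> Y) :=
  forall n (c : sig_part E n) (x : 'I_n -> X),
    g (alg_op c x) = alg_op c (g \o x).

Record factorization (E : continuousSignature) (X : semitopAlgebra E)
    (Z : topologicalType) (f : X -> Z) := Factorization {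
  fact_alg : semitopAlgebra E;
  fact_left : X -> fact_alg;
  fact_right : fact_alg -> Z;
  fact_left_continuous : continuous fact_left;
  fact_left_surjective : set_surj [set: X] [set: fact_alg] fact_left;
  fact_left_homomorphism : homomorphism fact_left;
  fact_right_continuous : continuous fact_right;
  fact_comp : f = fact_right \o fact_left }.

Definition fact_le (E : continuousSignature) (X : semitopAlgebra E)
    (Z : topologicalType) (f : X -> Z) (F1 F2 : factorization f) :=
  exists q : fact_alg F2 -> fact_alg F1,
    [/\ continuous q, homomorphism q & fact_left F1 = q \o fact_left F2].

(* Homeomorphism onto the image: the third clause says that e is open onto
   [range e] with the topology induced from T. *)
Definition topological_embedding (S T : topologicalType) (e : S -> T) :=
  [/\ injective e, continuous e &
      forall U : set S, open U -> open (e @` U : set (subspace (range e)))].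

(* Main.v *)
(* The least factorization is the image of X in Z^A, where A is the monoid of
   unary polynomials p : X -> X (composites of maps obtained by freezing all
   arguments but one of an operation) and x goes to the family f (p x).  Every
   homomorphism identifying two points identifies their images under p, which
   gives minimality; conversely the kernel of the map to Z^A is stable under
   operations, as arguments can be replaced one at a time.  Separate continuity
   survives because precomposing a coordinate by an elementary translation of
   the image gives another coordinate. *)
Require Import Defs.
From mathcomp Require Import all_boot.
From mathcomp Require Import all_classical all_analysis.

Set Implicit Arguments.
Unset Strict Implicit.
Unset Printing Implicit Defensive.

Local Open Scope classical_set_scope.

(** The pointwise topology is the supremum of the initial topologies of the evaluations at points of
    [A]. *)
Lemma continuous_ptwsP (T Z : topologicalType) (A : Type)
    (u : T -> {ptws A -> Z}) :
  continuous u <-> forall a, continuous (fun t => u t a).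
Proof.
split=> [cu a t|cu t].
  have /cvg_sup/(_ a) ut := cu t.
  exact: (cvg_comp _ _ ut (@initial_continuous _ _ (fun h : A -> Z => h a) _)).
apply/cvg_sup => a.
by apply: (@continuous_comp_initial _ _ _ (fun h : A -> Z => h a) u); exact: cu.
Qed.

Lemma continuous_set_typeP (T S : topologicalType) (B : set S) (u : T -> B) :
  continuous u <-> continuous (set_val \o u).
Proof.
split=> [cu t|]; last exact: continuous_comp_initial.
exact: (cvg_comp _ _ (cu t) (@initial_continuous _ _ set_val _)).
Qed.

Section Translations.
Context {E : continuousSignature}.

(** Kept as data rather than as a map [X -> X], so that a homomorphism can carry a translation to
    another algebra. The position [tr_pos] marks the free argument. *)
Record translation (X : Type) := Translation {
  tr_arity : nat;
  tr_const : sig_part E tr_arity;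
  tr_args : 'I_tr_arity -> X;
  tr_pos : 'I_tr_arity }.

Definition map_translation (X Y : Type) (g : X -> Y) (t : translation X) :=
  Translation (tr_const t) (g \o @tr_args _ t) (tr_pos t).

Definition translate (X : Type) (op : eAlgebra E X) (t : translation X) (x : X) :=
  op _ (tr_const t) (dfwith (@tr_args _ t) (tr_pos t) x).

(** The head of [s] acts last; thus [rcons s t] is [s] precomposed with [t]. *)
Definition polynomial (X : Type) (op : eAlgebra E X) (s : seq (translation X))
  (x : X) := foldr (translate op) x s.

Lemma polynomial_continuous (X : semitopAlgebra E) s :
  continuous (polynomial (@alg_op _ X) s).
Proof.
elim: s => [|t s IHs] x; first exact: cvg_id.
exact: (cvg_comp _ _ (IHs x) ((alg_sepcont X).2 _ _ _ _ _)).
Qed.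

Lemma comp_dfwith (X Y : Type) (g : X -> Y) n (a : 'I_n -> X) i x :
  g \o dfwith a i x = dfwith (g \o a) i (g x).
Proof.
apply/funext => j /=; have [<-|ij] := eqVneq i j; first by rewrite !dfwithin.
by rewrite !dfwithout.
Qed.

Lemma homomorphism_polynomial (X Y : semitopAlgebra E) (g : X -> Y) s x :
  homomorphism g ->
  g (polynomial (@alg_op _ X) s x) =
  polynomial (@alg_op _ Y) (map (map_translation g) s) (g x).
Proof.
by move=> gh; elim: s => //= t s IHs; rewrite /translate gh comp_dfwith IHs.
Qed.

Lemma congruence_translate (X W : Type) (op : eAlgebra E X) (k : X -> W) :
  (forall t x y, k x = k y -> k (translate op t x) = k (translate op t y)) ->
  forall n (c : sig_part E n) a b, k \o a = k \o b -> k (op n c a) = k (op n c b).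
Proof.
move=> kt n c a b kab.
(* A chain of tuples from [a] at [m = 0] to [b] at [m = n]. *)
pose mix m (i : 'I_n) := if i < m then b i else a i.
suff mixE m : m <= n -> k (op n c a) = k (op n c (mix m)).
  rewrite (mixE n) //; congr (k (op _ c _)).
  by apply/funext => i; rewrite /mix ltn_ord.
elim: m => [_|m IHm lt_mn].
  by congr (k (op _ c _)); apply/funext => i; rewrite /mix.
rewrite IHm; last exact: ltnW.
(* Consecutive tuples of the chain are values of one translation, at [a i0] and at [b i0]. *)
pose i0 := Ordinal lt_mn.
have mixa : mix m = dfwith (mix m) i0 (a i0).
  apply/funext => j; have [<-|ij] := eqVneq i0 j.
    by rewrite dfwithin /mix /= ltnn.
  by rewrite dfwithout.
have mixb : mix m.+1 = dfwith (mix m) i0 (b i0).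
  apply/funext => j; have [<-|ij] := eqVneq i0 j.
    by rewrite dfwithin /mix /= ltnSn.
  rewrite dfwithout // /mix ltnS leq_eqVlt.
  suff /negbTE -> : val j != m by [].
  by apply: contra ij => /eqP jm; apply/eqP/val_inj.
rewrite mixa mixb.
by apply: (kt (Translation c (mix m) i0)); exact: (congr1 (@^~ i0) kab).
Qed.

End Translations.

Section LeastFactorization.
Context {E : continuousSignature} {X : semitopAlgebra E} {Z : topologicalType}.
Variables (f : X -> Z) (f_continuous : continuous f).

Let A := seq (translation (E := E) X).
Let opX := @alg_op _ X.

Definition evaluations (x : X) : {ptws A -> Z} :=
  fun s => f (polynomial opX s x).

Definition least_space := set_type (range evaluations).

Lemma evaluations_range x : evaluations x \in range evaluations.
Proof. by apply/mem_set; exists x. Qed.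

Definition least_left (x : X) : least_space := SigSub (evaluations_range x).

Lemma least_leftE x s : set_val (least_left x) s = f (polynomial opX s x).
Proof. by []. Qed.

Lemma least_left_surj y : exists x, least_left x = y.
Proof. by case: y => y yP; have [x _ xy] := set_mem yP; exists x; apply/val_inj. Qed.

Definition least_repr y := projT1 (cid (least_left_surj y)).

Lemma least_reprK : cancel least_repr least_left.
Proof. by move=> y; rewrite /least_repr; case: cid. Qed.

Lemma least_left_eqP x y :
  least_left x = least_left y <->
  forall s, f (polynomial opX s x) = f (polynomial opX s y).
Proof.
split=> [/(congr1 set_val) xy s|xy]; first exact: (congr1 (@^~ s) xy).
by apply/val_inj/funext.
Qed.

Definition least_op : eAlgebra E least_space :=
  fun n c y => least_left (opX c (least_repr \o y)).

(** The choice of representatives in [least_op] is harmless: if [a] and [b] agree under all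
    polynomials, so do their images under [t], because [rcons s t] is again a polynomial. *)
Lemma least_left_op n (c : sig_part E n) x :
  least_left (opX c x) = least_op c (least_left \o x).
Proof.
apply: congruence_translate => [t a b /least_left_eqP ab|].
  by apply/least_left_eqP => s; have := ab (rcons s t); rewrite /polynomial !foldr_rcons.
by apply/funext => i /=; rewrite least_reprK.
Qed.

Lemma continuous_leastP (T : topologicalType) (u : T -> least_space) :
  continuous u <-> forall s, continuous (fun t => set_val (u t) s).
Proof. by rewrite continuous_set_typeP continuous_ptwsP. Qed.

Lemma least_left_continuous : continuous least_left.
Proof.
apply/continuous_leastP => s.
rewrite -[X in continuous X]/(f \o polynomial opX s) => x.
by apply: continuous_comp; [exact: polynomial_continuous|exact: f_continuous].
Qed.

Lemma least_op_sepcont : separately_continuous least_op.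
Proof.
split=> [n y c|n c y i].
  exact: (cvg_comp _ _ ((alg_sepcont X).1 _ _ _) (@least_left_continuous _)).
apply/continuous_leastP => s.
pose t := Translation c (least_repr \o y) i.
have -> : (fun z => set_val (least_op c (dfwith y i z)) s) =
    fun z => set_val z (rcons s t).
  apply/funext => z; rewrite -[in LHS](least_reprK z) -[in RHS](least_reprK z).
  have -> : y = least_left \o (least_repr \o y).
    by apply/funext => j /=; rewrite least_reprK.
  by rewrite -comp_dfwith -least_left_op !least_leftE /polynomial foldr_rcons.
by apply: (continuous_leastP id).1 => z; exact: cvg_id.
Qed.

Definition least_alg := SemitopAlgebra least_op_sepcont.

(** The empty list is the identity polynomial, so this coordinate recovers [f]. *)
Definition least_right (y : least_alg) : Z := set_val y [::].

Lemma least_right_continuous : continuous least_right.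
Proof. by apply: (continuous_leastP id).1 => z; exact: cvg_id. Qed.

Lemma least_left_set_surj :
  set_surj [set: X] [set: least_alg] (least_left : X -> least_alg).
Proof. by move=> y _; have [x] := least_left_surj y; exists x. Qed.

Definition least_factorization : factorization f :=
  @Factorization _ _ _ _ least_alg least_left least_right least_left_continuous
    least_left_set_surj least_left_op least_right_continuous erefl.

Lemma least_factorizationP (F : factorization f) : fact_le least_factorization F.
Proof.
case: F => Y g h gc gs gh hc fE.
have gsurj y : exists x, g x = y by have [x _ xy] := gs y I; exists x.
pose r y := projT1 (cid (gsurj y)).
have rK : cancel r g by move=> y; rewrite /r; case: cid.
(* Each coordinate of [least_left x] depends only on [g x], so [least_left] factors through [g]. *)
have fpE s x : f (polynomial opX s x) =
    h (polynomial (@alg_op _ Y) (map (map_translation g) s) (g x)).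
  by rewrite fE /= homomorphism_polynomial.
have qE x : least_left (r (g x)) = least_left x.
  by apply/least_left_eqP => s; rewrite !fpE rK.
exists (least_left \o r); split => /=.
- apply/continuous_leastP => s.
  (* The section [r] may be discontinuous, but it disappears from every coordinate, leaving [h]
     after a polynomial of [Y]. *)
  have -> : (fun y => set_val ((least_left \o r) y) s) =
      h \o polynomial (@alg_op _ Y) (map (map_translation g) s).
    by apply/funext => y; rewrite /= least_leftE fpE rK.
  by move=> y; apply: continuous_comp; [exact: polynomial_continuous|exact: hc].
- move=> n c y.
  have -> : y = g \o (r \o y) by apply/funext => i /=; rewrite rK.
  rewrite -gh /= qE least_left_op; congr least_op.
  by apply/funext => i /=; rewrite qE.
- by apply/funext => x /=; rewrite qE.
Qed.

Lemma least_embedding : topological_embedding (set_val : least_alg -> {ptws A -> Z}).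
Proof.
split; first exact: val_inj.
  exact: initial_continuous.
by move=> U oU; exact: initial_subspace_open.
Qed.

End LeastFactorization.

Theorem theorem16 (E : continuousSignature) (X : semitopAlgebra E)
    (Z : topologicalType) (f : X -> Z) (f_continuous : continuous f) :
  exists F : factorization f,
    (forall F' : factorization f, fact_le F F') /\
    (exists (A : Type) (e : fact_alg F -> {ptws A -> Z}),
       topological_embedding e).
Proof.
exists (least_factorization f_continuous); split.
  exact: least_factorizationP.
by exists (seq (translation X)), set_val; exact: least_embedding.
Qed.
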